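(* Let $a\in\mathbb{Q}$. There is a constant $C_a>0$, depending on the slope $a$ but not on $\lambda$, such that for every geodesic segment $\gamma\subset\mathbb{T}^2$ of unit length with slope $a$, every $\lambda>1$ and every eigenfunction $e_\lambda$ on $\mathbb{T}^2$ with $-\Delta e_\lambda=\lambda^2e_\lambda$, $$\|e_\lambda\|_{L^2(\gamma)}\le C_a\|e_\lambda\|_{L^2(\mathbb{T}^2)}.$$
   Context: $\mathbb{T}^2=\mathbb{R}^2/(2\pi\mathbb{Z})^2$ is the standard flat torus and $\Delta$ its Laplace-Beltrami operator. Eigenfunctions are complex valued; those with $-\Delta e_\lambda=\lambda^2e_\lambda$ are exactly the finite sums $e_\lambda(x)=\sum_{n\in\mathbb{Z}^2,\,|n|=\lambda}c_ne^{in\cdot x}$. A geodesic segment with slope $a$ is the image in $\mathbb{T}^2$ of a segment of a straight line of slope $a$ in $\mathbb{R}^2$; $L^2(\gamma)$ is taken with respect to arc length along the segment. *)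

(* Defs.v *)
From Stdlib Require Import Reals ZArith QArith Qreals.
From Coquelicot Require Import Coquelicot.
Open Scope R_scope.

(* A function on T^2 = R^2 / (2 pi Z)^2 is represented by its lift to R^2,
   written in curried form as in Coquelicot's two-variable calculus. *)
Definition on_torus (e : R -> R -> C) : Prop :=
  forall (m n : Z) (x y : R), e (x + 2 * PI * IZR m) (y + 2 * PI * IZR n) = e x y.

Definition of_class_C2 (e : R -> R -> C) : Prop :=
  forall x y : R,
    ex_diff_n (fun u v => Re (e u v)) 2 x y /\
    ex_diff_n (fun u v => Im (e u v)) 2 x y.

Definition real_laplacian (f : R -> R -> R) (x y : R) : R :=
  partial_derive 2 0 f x y + partial_derive 0 2 f x y.

Definition laplacian (e : R -> R -> C) (x y : R) : C :=
  (real_laplacian (fun u v => Re (e u v)) x y,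
   real_laplacian (fun u v => Im (e u v)) x y).

(* The zero function is allowed. *)
Definition eigenfunction (lambda : R) (e : R -> R -> C) : Prop :=
  on_torus e /\ of_class_C2 e /\
  forall x y : R, Copp (laplacian e x y) = Cmult (RtoC (lambda ^ 2)) (e x y).

(* The integrand is continuous whenever e is, so the Riemann integrals over a
   fundamental domain give the L^2 norm for the area measure of T^2. *)
Definition L2norm_torus (e : R -> R -> C) : R :=
  sqrt (RInt (fun x => RInt (fun y => Cmod (e x y) ^ 2) 0 (2 * PI)) 0 (2 * PI)).

(* A geodesic segment of T^2 is given by the end points P and Q of a lift to
   R^2; it is the image of t |-> P + t (Q - P), 0 <= t <= 1. *)
Definition segment_length (P Q : R * R) : R :=
  sqrt ((fst Q - fst P) ^ 2 + (snd Q - snd P) ^ 2).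

(* For P <> Q. *)
Definition has_slope (a : R) (P Q : R * R) : Prop :=
  snd Q - snd P = a * (fst Q - fst P).

(* The factor segment_length P Q turns dt into arc length.  A segment whose
   image in T^2 overlaps itself would be counted with multiplicity; this does
   not happen for length less than 2 pi, the length of the shortest closed
   geodesics. *)
Definition L2norm_segment (e : R -> R -> C) (P Q : R * R) : R :=
  sqrt (RInt (fun t => Cmod (e (fst P + t * (fst Q - fst P))
                               (snd P + t * (snd Q - snd P))) ^ 2
                       * segment_length P Q) 0 1).

(* Main.v *)
Require Import Defs.
From Stdlib Require Import Reals ZArith QArith Qreals Lra Lia Psatz.
From Coquelicot Require Import Coquelicot.
Open Scope R_scope.

(* Let a = p/q and w = (q, p).  In the coordinates x = x0 + s w + t w', with w'
   the vector (-p, q) orthogonal to w, an eigenfunction becomes a function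
   E(s, t), 2 pi-periodic in both variables, with E_ss + E_tt = - M E, and the
   segment becomes part of the circle t = 0.  No Fourier series is needed to
   bound the L^2 norm on that circle.  After replacing E by its even part in t,
   K(a, b) = int E(s, a) E(s, b) ds satisfies the wave equation K_aa = K_bb, so
   d'Alembert's formula gives K(a, b) = (Phi(a - b) + Phi(a + b)) / 2 with
   Phi = K(., 0).  The mean of Phi over a period is nonnegative, since it is
   proportional to int (int E dt)^2 ds; integrating
   K(t, t) = (Phi(0) + Phi(2 t)) / 2 over a period therefore bounds
   Phi(0) = int E(s, 0)^2 ds by (2 / T) int int E^2.  Finally, the map
   (s, t) -> x0 + s w + t w' covers the torus finitely many times, which
   compares int int E^2 with the L^2 norm of the eigenfunction. *)

(** * Joint continuity of functions of two real variables *)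

Definition cont2 (f : R -> R -> R) : Prop :=
  forall x y : R, continuity_2d_pt f x y.

Lemma cont2_comp (f g h : R -> R -> R) :
  cont2 f -> cont2 g -> cont2 h -> cont2 (fun x y => f (g x y) (h x y)).
Proof.
intros Hf Hg Hh x y.
apply continuity_2d_pt_filterlim.
apply (filterlim_comp_2 (G := locally (g x y)) (H := locally (h x y))
  (fun z : R * R => g (fst z) (snd z)) (fun z : R * R => h (fst z) (snd z)) f).
- apply continuity_2d_pt_filterlim, Hg.
- apply continuity_2d_pt_filterlim, Hh.
- intros P HP.
  apply (proj1 (continuity_2d_pt_filterlim f _ _) (Hf _ _)) in HP.
  destruct HP as [d Hd].
  exists (fun u => ball (g x y) d u) (fun v => ball (h x y) d v).
  + now exists d.
  + now exists d.
  + intros u v Hu Hv. exact (Hd (u, v) (conj Hu Hv)).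
Qed.

Lemma cont2_plus (f g : R -> R -> R) :
  cont2 f -> cont2 g -> cont2 (fun x y => f x y + g x y).
Proof. intros Hf Hg x y. now apply continuity_2d_pt_plus. Qed.

Lemma cont2_minus (f g : R -> R -> R) :
  cont2 f -> cont2 g -> cont2 (fun x y => f x y - g x y).
Proof. intros Hf Hg x y. now apply continuity_2d_pt_minus. Qed.

Lemma cont2_mult (f g : R -> R -> R) :
  cont2 f -> cont2 g -> cont2 (fun x y => f x y * g x y).
Proof. intros Hf Hg x y. now apply continuity_2d_pt_mult. Qed.

Lemma cont2_const (c : R) : cont2 (fun _ _ => c).
Proof. intros x y. apply continuity_2d_pt_const. Qed.

Lemma cont2_fst : cont2 (fun x _ => x).
Proof. intros x y. apply continuity_2d_pt_id1. Qed.

Lemma cont2_snd : cont2 (fun _ y => y).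
Proof. intros x y. apply continuity_2d_pt_id2. Qed.

Lemma cont2_opp (f : R -> R -> R) : cont2 f -> cont2 (fun x y => - f x y).
Proof. intros Hf x y. now apply continuity_2d_pt_opp. Qed.

Lemma cont2_pow (f : R -> R -> R) (n : nat) :
  cont2 f -> cont2 (fun x y => f x y ^ n).
Proof.
intros Hf; induction n as [|n IH]; simpl.
- apply cont2_const.
- now apply cont2_mult.
Qed.

(** The composition case stands last because sums, differences and products match it too, with
    [Rplus], [Rminus] or [Rmult] as outer function. *)
Ltac cont2_tac :=
  repeat first
    [ assumption
    | match goal with
      | |- cont2 (fun _ _ => ?c) => apply (cont2_const c)
      | |- cont2 (fun x _ => x) => apply cont2_fst
      | |- cont2 (fun _ y => y) => apply cont2_snd
      | |- cont2 (fun _ _ => _ + _) => apply cont2_plus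
      | |- cont2 (fun _ _ => _ - _) => apply cont2_minus
      | |- cont2 (fun _ _ => _ * _) => apply cont2_mult
      | |- cont2 (fun _ _ => - _) => apply cont2_opp
      | |- cont2 (fun _ _ => _ ^ _) => apply cont2_pow
      | |- cont2 (fun x y => ?f (@?g x y) (@?h x y)) => apply (cont2_comp f g h)
      end ].

Lemma cont2_continuous (f : R -> R -> R) (g h : R -> R) (x : R) :
  cont2 f -> (forall x, continuous g x) -> (forall x, continuous h x) ->
  continuous (fun t => f (g t) (h t)) x.
Proof.
intros Hf Hg Hh.
apply continuous_comp_2; try apply Hg; try apply Hh.
exact (proj1 (continuity_2d_pt_filterlim f _ _) (Hf _ _)).
Qed.

Lemma cont2_l (f : R -> R -> R) (y x : R) : cont2 f -> continuous (fun t => f t y) x.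
Proof.
intros Hf. apply (cont2_continuous f (fun t => t) (fun _ => y)); auto.
- intros; apply continuous_id.
- intros; apply continuous_const.
Qed.

Lemma cont2_r (f : R -> R -> R) (y x : R) : cont2 f -> continuous (fun t => f y t) x.
Proof.
intros Hf. apply (cont2_continuous f (fun _ => y) (fun t => t)); auto.
- intros; apply continuous_const.
- intros; apply continuous_id.
Qed.

(** * Riemann integrals of continuous functions *)

Lemma ex_RInt_cont (f : R -> R) (a b : R) :
  (forall x, continuous f x) -> ex_RInt f a b.
Proof. intros Hf. apply @ex_RInt_continuous. intros; apply Hf. Qed.

Lemma continuous_RInt_param (f : R -> R -> R) (a b x : R) :
  cont2 f -> continuous (fun u => RInt (fun t => f u t) a b) x.
Proof.
intros Hf.
assert (main : forall a b, a <= b ->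
  continuous (fun u => RInt (fun t => f u t) a b) x).
{ clear a b. intros a b Hab.
  apply filterlim_locally. intros eps.
  (* The added 1 keeps the denominator positive when [a = b] and leaves a strict inequality at the
     end. *)
  assert (He : 0 < eps / (b - a + 1)).
  { apply Rdiv_lt_0_compat; [apply cond_pos | lra]. }
  destruct (uniform_continuity_2d_1d' f a b x (fun t _ => Hf x t)
     (mkposreal _ He)) as [d Hd].
  exists d. intros u Hu.
  change (Rabs (RInt (fun t => f u t) a b - RInt (fun t => f x t) a b) < eps).
  change (Rabs (u - x) < d) in Hu. apply Rabs_lt_between in Hu.
  rewrite <- (RInt_minus (V := R_CompleteNormedModule) (f u) (f x));
    try (apply ex_RInt_cont; intros; now apply cont2_r).
  apply Rle_lt_trans with ((b - a) * (eps / (b - a + 1))).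
  - apply abs_RInt_le_const; auto.
    + apply ex_RInt_cont; intros. apply @continuous_minus; now apply cont2_r.
    + intros t Ht. left. change (Rabs (f u t - f x t) < eps / (b - a + 1)).
      assert (Hd0 := cond_pos d).
      apply Hd; try lra.
      rewrite Rminus_diag, Rabs_R0. exact Hd0.
  - replace (pos eps) with ((b - a + 1) * (eps / (b - a + 1))) at 2
      by (field; lra).
    lra. }
destruct (Rle_dec a b) as [h|h]; [now apply main|].
apply continuous_ext with (fun u => opp (RInt (fun t => f u t) b a)).
- intros u. apply opp_RInt_swap. apply ex_RInt_cont; intros; now apply cont2_r.
- apply @continuous_opp. apply main. lra.
Qed.

Lemma is_derive_RInt_param_cont (f df : R -> R -> R) (a b x : R) :
  (forall u t, is_derive (fun u => f u t) u (df u t)) ->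
  (forall u t, continuous (f u) t) -> cont2 df ->
  is_derive (fun u => RInt (fun t => f u t) a b) x (RInt (fun t => df x t) a b).
Proof.
intros Hd Hf Hdf.
assert (HD : forall u t, Derive (fun z => f z t) u = df u t).
{ intros; apply is_derive_unique, Hd. }
rewrite <- (RInt_ext (fun t => Derive (fun z => f z t) x) (fun t => df x t))
  by (intros; apply HD).
apply (is_derive_RInt_param f a b x).
- apply filter_forall. intros u t _. eexists; apply Hd.
- intros t _. apply continuity_2d_pt_ext with df; [|apply Hdf].
  intros; symmetry; apply HD.
- apply filter_forall. intros u. now apply ex_RInt_cont.
Qed.

Lemma is_derive_0_eq (f : R -> R) :
  (forall x, is_derive f x 0) -> forall a b, f a = f b.
Proof.
intros Hf.
assert (H : forall a b, a < b -> f a = f b).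
{ intros a b Hab. apply (eq_is_derive f a b); auto. }
intros a b. destruct (Rtotal_order a b) as [h|[h|h]].
- auto.
- now rewrite h.
- symmetry; auto.
Qed.

Lemma is_derive_RInt_cont (f : R -> R) (a x : R) :
  (forall t, continuous f t) -> is_derive (fun u => RInt f a u) x (f x).
Proof.
intros Hf. apply is_derive_RInt with a; [|apply Hf].
apply filter_forall. intros u.
apply (RInt_correct (V := R_CompleteNormedModule)). now apply ex_RInt_cont.
Qed.

(** As functions of the upper bound [X] of the integral in [x], both sides vanish at [X = a] and
    have the same derivative, the integral of [f X y] in [y]; so their difference [D] is
    constant. *)
Lemma RInt_fubini (f : R -> R -> R) (a b c d : R) :
  cont2 f ->
  RInt (fun x => RInt (fun y => f x y) c d) a b =
  RInt (fun y => RInt (fun x => f x y) a b) c d.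
Proof.
intros Hf.
assert (Hf' : cont2 (fun y x => f x y)).
{ exact (cont2_comp f _ _ Hf cont2_snd cont2_fst). }
set (D X := RInt (fun x => RInt (fun y => f x y) c d) a X
          - RInt (fun y => RInt (fun x => f x y) a X) c d).
enough (H : D b = D a).
{ unfold D in H. rewrite RInt_point in H.
  rewrite (RInt_ext (fun y => RInt (fun x => f x y) a a) (fun _ => 0)) in H
    by (intros; apply (RInt_point (V := R_CompleteNormedModule))).
  rewrite RInt_const in H. unfold scal, zero in H; simpl in H.
  unfold mult in H; simpl in H. lra. }
apply is_derive_0_eq. intros X. unfold D.
replace 0 with (RInt (fun y => f X y) c d - RInt (fun y => f X y) c d) by ring.
apply (is_derive_minus (V := R_NormedModule)).
- apply (is_derive_RInt_cont (fun x => RInt (fun y => f x y) c d)).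
  intros; now apply continuous_RInt_param.
- apply (is_derive_RInt_param_cont (fun X y => RInt (fun x => f x y) a X) f); auto.
  + intros u t. apply (is_derive_RInt_cont (fun x => f x t)).
    intros; now apply cont2_l.
  + intros u t. now apply (continuous_RInt_param (fun y x => f x y)).
Qed.

Lemma RInt_shift (f : R -> R) (a b c : R) :
  (forall x, continuous f x) ->
  RInt (fun x => f (x + c)) a b = RInt f (a + c) (b + c).
Proof.
intros Hf.
replace (RInt f (a + c) (b + c)) with (RInt f (1 * a + c) (1 * b + c))
  by (f_equal; ring).
rewrite <- (RInt_comp_lin f 1 c a b) by now apply ex_RInt_cont.
apply RInt_ext. intros x _. unfold scal; simpl; unfold mult; simpl.
now rewrite !Rmult_1_l.
Qed.

(** The factor [k] stays on the left so that zero and negative values are covered. *)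
Lemma RInt_scale (f : R -> R) (k a b : R) :
  (forall x, continuous f x) ->
  k * RInt (fun x => f (k * x)) a b = RInt f (k * a) (k * b).
Proof.
intros Hf.
replace (RInt f (k * a) (k * b)) with (RInt f (k * a + 0) (k * b + 0))
  by (f_equal; ring).
rewrite <- (RInt_comp_lin f k 0 a b) by now apply ex_RInt_cont.
rewrite <- (RInt_scal (V := R_CompleteNormedModule)).
- apply RInt_ext. intros x _. now rewrite Rplus_0_r.
- apply ex_RInt_cont. intros x. apply (continuous_comp (fun x => k * x) f); auto.
  apply (continuous_scal_r k (fun x : R => x)). apply continuous_id.
Qed.

Lemma RInt_chasles (f : R -> R) (a b c : R) :
  (forall x, continuous f x) -> RInt f a b + RInt f b c = RInt f a c.
Proof.
intros Hf. apply (RInt_Chasles (V := R_CompleteNormedModule));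
now apply ex_RInt_cont.
Qed.

Lemma RInt_period (f : R -> R) (T c : R) :
  (forall x, continuous f x) -> (forall x, f (x + T) = f x) ->
  RInt f c (c + T) = RInt f 0 T.
Proof.
intros Hf HT.
assert (H : RInt f 0 c = RInt f (0 + T) (c + T)).
{ rewrite <- RInt_shift by auto. apply RInt_ext; intros; now rewrite HT. }
rewrite Rplus_0_l in H.
generalize (RInt_chasles f 0 c (c + T) Hf) (RInt_chasles f 0 T (c + T) Hf).
lra.
Qed.

(* The values of [RInt] live in the carrier of a normed module, which [ring]
   and [field] do not recognize as [R]. *)
Ltac eq_R := match goal with |- ?u = ?v => change (@eq R u v) end.

Lemma RInt_periods (f : R -> R) (T c : R) (n : nat) :
  (forall x, continuous f x) -> (forall x, f (x + T) = f x) ->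
  RInt f c (c + INR n * T) = INR n * RInt f 0 T.
Proof.
intros Hf HT. induction n as [|n IH].
- simpl. rewrite !Rmult_0_l, Rplus_0_r.
  apply (RInt_point (V := R_CompleteNormedModule)).
- rewrite S_INR.
  rewrite <- (RInt_chasles f c (c + INR n * T)) by auto.
  rewrite IH.
  replace (c + (INR n + 1) * T) with ((c + INR n * T) + T) by ring.
  rewrite RInt_period by auto.
  eq_R. ring.
Qed.

Lemma RInt_Rplus (f g : R -> R) (a b : R) :
  (forall x, continuous f x) -> (forall x, continuous g x) ->
  RInt (fun x => f x + g x) a b = RInt f a b + RInt g a b.
Proof.
intros Hf Hg. apply (RInt_plus (V := R_CompleteNormedModule));
now apply ex_RInt_cont.
Qed.

Lemma RInt_Rmult (f : R -> R) (k a b : R) :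
  (forall x, continuous f x) ->
  RInt (fun x => k * f x) a b = k * RInt f a b.
Proof.
intros Hf. apply (RInt_scal (V := R_CompleteNormedModule)).
now apply ex_RInt_cont.
Qed.

Lemma RInt_ge0 (f : R -> R) (a b : R) :
  a <= b -> (forall x, continuous f x) -> (forall x, 0 <= f x) ->
  0 <= RInt f a b.
Proof. intros. apply RInt_ge_0; auto. now apply ex_RInt_cont. Qed.

(** * Derivatives along affine maps, and doubly periodic solutions *)

Lemma is_derive_Rmult (f g : R -> R) (x df dg : R) :
  is_derive f x df -> is_derive g x dg ->
  is_derive (fun x => f x * g x) x (df * g x + f x * dg).
Proof.
intros Hf Hg. apply (is_derive_mult f g x df dg Hf Hg).
intros; apply Rmult_comm.
Qed.

Lemma is_derive_affine (f : R -> R) (a k x d : R) :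
  is_derive f (a + k * x) d ->
  is_derive (fun x => f (a + k * x)) x (k * d).
Proof.
intros Hf.
apply (is_derive_comp f (fun x => a + k * x) x d k Hf).
auto_derive; auto; ring.
Qed.

Lemma is_derive_shift (f : R -> R) (a x d : R) :
  is_derive f (a + x) d -> is_derive (fun x => f (a + x)) x d.
Proof.
intros Hf. rewrite <- (Rmult_1_l d).
apply is_derive_ext with (fun x => f (a + 1 * x)).
- intros; now rewrite Rmult_1_l.
- apply is_derive_affine. now rewrite Rmult_1_l.
Qed.

(** The derivatives are explicit functions rather than terms in [Derive], so that the even part of a
    solution can be formed field by field. *)
Record periodic_solution (T M : R) (E Es Ess Et Ett : R -> R -> R) : Prop := {
  dEs : forall s t, is_derive (fun s => E s t) s (Es s t);
  dEss : forall s t, is_derive (fun s => Es s t) s (Ess s t);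
  dEt : forall s t, is_derive (fun t => E s t) t (Et s t);
  dEtt : forall s t, is_derive (fun t => Et s t) t (Ett s t);
  cE : cont2 E;
  cEs : cont2 Es;
  cEss : cont2 Ess;
  cEt : cont2 Et;
  cEtt : cont2 Ett;
  eqE : forall s t, Ess s t + Ett s t = - M * E s t;
  perS : forall s t, E (s + T) t = E s t;
  perT : forall s t, E s (t + T) = E s t
}.

(** * Mean square of an even solution on the line t = 0 *)

Section Slice.

Context (T M : R) (E Es Ess Et Ett : R -> R -> R).
Context (HT : 0 < T) (HE : periodic_solution T M E Es Ess Et Ett).
Context (even : forall s t, E s (- t) = E s t).

Let K (a b : R) : R := RInt (fun s => E s a * E s b) 0 T.
Let G (a b : R) : R := RInt (fun s => Et s a * E s b - E s a * Et s b) 0 T.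
Let Phi (t : R) : R := K t 0.

Lemma Es_periodic s t : Es (s + T) t = Es s t.
Proof.
rewrite <- (is_derive_unique _ _ _ (dEs _ _ _ _ _ _ _ HE s t)).
symmetry. apply is_derive_unique.
apply is_derive_ext with (fun s => E (T + 1 * s) t).
- intros u. rewrite Rmult_1_l, Rplus_comm. apply (perS _ _ _ _ _ _ _ HE).
- rewrite <- (Rmult_1_l (Es (s + T) t)).
  apply (is_derive_affine (fun s => E s t)).
  rewrite Rmult_1_l, Rplus_comm. apply (dEs _ _ _ _ _ _ _ HE).
Qed.

(** The derivative of an even function is odd. This identifies the derivative of [Phi] at [x] with
    [G x 0]. *)
Lemma Et_at_0 s : Et s 0 = 0.
Proof.
assert (H := dEt _ _ _ _ _ _ _ HE s 0).
assert (H' : is_derive (fun t => E s t) 0 (-1 * Et s 0)).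
{ apply is_derive_ext with (fun t => E s (0 + -1 * t)).
  - intros t. rewrite <- (even s t). f_equal. ring.
  - apply (is_derive_affine (fun t => E s t)).
    rewrite Rmult_0_r, Rplus_0_r. exact H. }
apply is_derive_unique in H, H'. rewrite H in H'. lra.
Qed.

(** The equation trades [t]-derivatives for [s]-derivatives and the terms in [M] cancel; what
    remains is the [s]-derivative of the Wronskian [W], which takes the same value at 0 and [T]. *)
Lemma green a b :
  RInt (fun s => Ett s a * E s b - E s a * Ett s b) 0 T = 0.
Proof.
set (W s := E s a * Es s b - Es s a * E s b).
assert (HW : is_RInt (fun s => Ett s a * E s b - E s a * Ett s b) 0 T (minus (W T) (W 0))).
{ apply (is_RInt_derive W).
  - intros s _. unfold W.
    replace (Ett s a * E s b - E s a * Ett s b) with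
      ((Es s a * Es s b + E s a * Ess s b) - (Ess s a * E s b + Es s a * Es s b))
      by (generalize (eqE _ _ _ _ _ _ _ HE s a) (eqE _ _ _ _ _ _ _ HE s b);
          intros ? ?; replace (Ess s a) with (- M * E s a - Ett s a) by lra;
          replace (Ess s b) with (- M * E s b - Ett s b) by lra; ring).
    apply (is_derive_minus (V := R_NormedModule));
    apply (is_derive_Rmult (fun s => _ s _) (fun s => _ s _));
    apply (dEs _ _ _ _ _ _ _ HE) || apply (dEss _ _ _ _ _ _ _ HE).
  - intros s _. apply (cont2_continuous (fun s _ => Ett s a * E s b - E s a * Ett s b) (fun s => s) (fun s => s)).
    + destruct HE. cont2_tac.
    + intros; apply continuous_id.
    + intros; apply continuous_id. }
rewrite (is_RInt_unique (V := R_CompleteNormedModule) _ _ _ _ HW).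
unfold W.
replace T with (0 + T) at 1 2 3 4 by ring.
rewrite !Es_periodic, !(perS _ _ _ _ _ _ _ HE). apply Rminus_diag.
Qed.

(** The parameter [k] serves two uses: [k = 0] differentiates [Phi], and [k = -1] follows the
    direction in which the derivative of [K] is [G]. *)
Lemma dK a b k x :
  is_derive (fun x => K (a + x) (b + k * x)) x
    (RInt (fun s => Et s (a + x) * E s (b + k * x) + E s (a + x) * (k * Et s (b + k * x))) 0 T).
Proof.
unfold K.
apply (is_derive_RInt_param_cont (fun x s => E s (a + x) * E s (b + k * x))
  (fun x s => Et s (a + x) * E s (b + k * x) + E s (a + x) * (k * Et s (b + k * x)))).
- intros u t.
  apply (is_derive_Rmult (fun u => E t (a + u)) (fun u => E t (b + k * u))).
  + apply (is_derive_shift (E t)), (dEt _ _ _ _ _ _ _ HE).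
  + apply (is_derive_affine (E t)), (dEt _ _ _ _ _ _ _ HE).
- intros u t. apply (cont2_r (fun x s => E s (a + x) * E s (b + k * x))).
  destruct HE; cont2_tac.
- destruct HE; cont2_tac.
Qed.

(* [G] is the derivative of [K] in the direction (1, -1); the wave equation makes
   it constant in the direction (1, 1). *)
Lemma dG a b x : is_derive (fun x => G (a + x) (b + x)) x 0.
Proof.
rewrite <- (green (a + x) (b + x)).
unfold G.
apply (is_derive_RInt_param_cont (fun x s => Et s (a + x) * E s (b + x) - E s (a + x) * Et s (b + x))
  (fun x s => Ett s (a + x) * E s (b + x) - E s (a + x) * Ett s (b + x))).
- intros u t.
  replace (Ett t (a + u) * E t (b + u) - E t (a + u) * Ett t (b + u)) with
   ((Ett t (a + u) * E t (b + u) + Et t (a + u) * Et t (b + u)) - (Et t (a + u) * Et t (b + u) + E t (a + u) * Ett t (b + u))) by ring.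
  apply (is_derive_minus (V := R_NormedModule));
    [ apply (is_derive_Rmult (fun u => Et t (a + u)) (fun u => E t (b + u)))
    | apply (is_derive_Rmult (fun u => E t (a + u)) (fun u => Et t (b + u))) ].
  + apply (is_derive_shift (Et t)), (dEtt _ _ _ _ _ _ _ HE).
  + apply (is_derive_shift (E t)), (dEt _ _ _ _ _ _ _ HE).
  + apply (is_derive_shift (E t)), (dEt _ _ _ _ _ _ _ HE).
  + apply (is_derive_shift (Et t)), (dEtt _ _ _ _ _ _ _ HE).
- intros u t. apply (cont2_r (fun x s => Et s (a + x) * E s (b + x) - E s (a + x) * Et s (b + x))).
  destruct HE; cont2_tac.
- destruct HE; cont2_tac.
Qed.

Lemma G_diff a b : G a b = G (a - b) 0.
Proof.
assert (H := is_derive_0_eq _ (dG (a - b) 0) b 0).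
simpl in H. rewrite !Rplus_0_r, Rplus_0_l in H.
now replace (a - b + b) with a in H by ring.
Qed.

Lemma dPhi x : is_derive Phi x (G x 0).
Proof.
assert (H := dK 0 0 0 x).
replace (G x 0) with (RInt (fun s => Et s (0 + x) * E s (0 + 0 * x) + E s (0 + x) * (0 * Et s (0 + 0 * x))) 0 T).
- revert H. apply is_derive_ext. intros t. unfold Phi. f_equal; ring.
- unfold G. apply RInt_ext. intros s _. rewrite Et_at_0.
  rewrite Rplus_0_l, Rmult_0_l, Rplus_0_r. eq_R. ring.
Qed.

(** Along (t + x, t - x) the derivative of [K] is [G (t + x) (t - x) = G (2 * x) 0], the derivative
    of [Phi] at [2 * x]. Hence [K] differs from [Phi (2 * x) / 2] by a constant on this line. *)
Lemma dalembert a b : K a b = (Phi (a - b) + Phi (a + b)) / 2.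
Proof.
set (t := (a + b) / 2). set (u := (a - b) / 2).
assert (D : forall x, is_derive (fun x => K (t + x) (t + -1 * x) - / 2 * Phi (0 + 2 * x)) x 0).
{ intros x.
  match goal with |- is_derive ?f _ _ => set (F := f) end.
  replace 0 with (G (2 * x) 0 - / 2 * (2 * G (0 + 2 * x) 0))
    by (rewrite Rplus_0_l; field).
  subst F.
  apply (is_derive_minus (V := R_NormedModule)).
  - replace (G (2 * x) 0) with (G (t + x) (t + - 1 * x))
      by (rewrite G_diff; f_equal; ring).
    generalize (dK t t (-1) x).
    unfold G. rewrite (RInt_ext _ (fun s => Et s (t + x) * E s (t + -1 * x) -
     E s (t + x) * Et s (t + -1 * x))); auto.
    intros s _. eq_R. ring.
  - apply (is_derive_scal (fun x => Phi (0 + 2 * x))). apply is_derive_affine, dPhi. }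
(* The line passes through (a, b) at [x = u], and through (a + b, 0), where [K] is [Phi (a + b)], at
   [x = t]. *)
assert (H := is_derive_0_eq _ D u t). simpl in H.
replace (t + u) with a in H by (unfold t, u; field).
replace (t + -1 * u) with b in H by (unfold t, u; field).
replace (t + -1 * t) with 0 in H by ring.
fold (Phi (t + t)) in H.
replace (t + t) with (a + b) in H by (unfold t; field).
replace (0 + 2 * u) with (a - b) in H by (unfold u; field).
replace (0 + 2 * t) with (a + b) in H by (unfold t; field).
lra.
Qed.

Lemma cPhi x : continuous Phi x.
Proof. apply (ex_derive_continuous Phi). eexists; apply dPhi. Qed.

Lemma perPhi x : Phi (x + T) = Phi x.
Proof.
unfold Phi, K. apply RInt_ext. intros s _.
now rewrite (perT _ _ _ _ _ _ _ HE).
Qed.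

Lemma cPhi_affine k c x : continuous (fun x => Phi (k * x + c)) x.
Proof.
apply (continuous_comp (fun x => k * x + c) Phi); [|apply cPhi].
apply (ex_derive_continuous (fun x => k * x + c)). auto_derive; auto.
Qed.

Lemma Phi_mean : 0 <= RInt Phi 0 T.
Proof.
set (c := RInt Phi 0 T).
set (A s := RInt (fun a => E s a) 0 T).
assert (cA : forall s, continuous A s).
{ intros s. apply continuous_RInt_param, (cE _ _ _ _ _ _ _ HE). }
assert (cK : cont2 E) by apply (cE _ _ _ _ _ _ _ HE).
(* By d'Alembert's formula this is the average of the integrals of two translates of [Phi], each
   equal to [c] by periodicity. *)
assert (H1 : forall b, RInt (fun a => K a b) 0 T = c).
{ intros b.
  rewrite (RInt_ext _ (fun a => / 2 * (Phi (a + - b) + Phi (a + b)))).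
  2: { intros a _. rewrite dalembert. eq_R. unfold Rminus. field. }
  assert (cP : forall d a, continuous (fun a => Phi (a + d)) a).
  { intros d a. apply continuous_ext with (fun a => Phi (1 * a + d)).
    - intros; now rewrite Rmult_1_l.
    - apply cPhi_affine. }
  rewrite (RInt_Rmult (fun a => Phi (a + - b) + Phi (a + b)))
    by (intros; apply @continuous_plus; apply cP).
  rewrite (RInt_Rplus (fun a => Phi (a + - b)) (fun a => Phi (a + b)))
    by apply cP.
  rewrite !(RInt_shift Phi) by apply cPhi.
  rewrite !Rplus_0_l, !(Rplus_comm T).
  rewrite !RInt_period by (apply cPhi || apply perPhi).
  fold c. eq_R. field. }
assert (H2 : forall b, RInt (fun s => A s * E s b) 0 T = c).
{ intros b. rewrite <- (H1 b). unfold K.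
  rewrite (RInt_fubini (fun a s => E s a * E s b)) by cont2_tac.
  apply RInt_ext. intros s _. unfold A.
  rewrite Rmult_comm.
  rewrite <- RInt_Rmult by (intros; now apply cont2_r).
  apply RInt_ext. intros a _. apply Rmult_comm. }
(* Integrating the previous identity over [b] turns [E s b] into a second factor [A s]. *)
assert (H3 : T * c = RInt (fun s => A s * A s) 0 T).
{ transitivity (RInt (fun b => RInt (fun s => A s * E s b) 0 T) 0 T).
  - rewrite (RInt_ext _ (fun _ => c)) by (intros; apply H2).
    rewrite RInt_const. unfold scal; simpl; unfold mult; simpl. eq_R; ring.
  - rewrite (RInt_fubini (fun b s => A s * E s b)).
    + apply RInt_ext. intros s _. unfold A at 3.
      now rewrite <- RInt_Rmult by (intros; now apply cont2_r).
    + apply cont2_mult; [|cont2_tac].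
      intros x y. apply (continuity_1d_2d_pt_comp A (fun _ y => y)).
      * apply continuity_pt_filterlim, cA.
      * apply continuity_2d_pt_id2. }
assert (0 <= T * c).
{ rewrite H3. apply RInt_ge0; [lra| |].
  - intros; apply (continuous_mult A A); apply cA.
  - intros; nra. }
nra.
Qed.

Lemma slice_bound_even :
  T / 2 * RInt (fun s => E s 0 ^ 2) 0 T <=
  RInt (fun t => RInt (fun s => E s t ^ 2) 0 T) 0 T.
Proof.
replace (RInt (fun s => E s 0 ^ 2) 0 T) with (Phi 0)
  by (apply RInt_ext; intros; unfold pow; eq_R; ring).
rewrite (RInt_ext _ (fun t => / 2 * (Phi 0 + Phi (2 * t)))).
2: { intros t _. transitivity (K t t).
     - apply RInt_ext; intros; unfold pow; eq_R; ring.
     - rewrite dalembert. replace (t - t) with 0 by ring.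
       replace (t + t) with (2 * t) by ring. eq_R. field. }
assert (c2 : forall x, continuous (fun t => Phi (2 * t)) x).
{ intros x. apply continuous_ext with (fun a => Phi (2 * a + 0)).
  - intros; now rewrite Rplus_0_r.
  - apply cPhi_affine. }
rewrite (RInt_Rmult (fun t => Phi 0 + Phi (2 * t))).
2: { intros; apply @continuous_plus; auto. apply continuous_const. }
rewrite (RInt_Rplus (fun _ => Phi 0)); auto.
2: { intros; apply continuous_const. }
rewrite RInt_const. unfold scal; simpl; unfold mult; simpl.
(* Doubling the variable runs through two periods, so [Phi (2 * t)] has the same integral over
   [[0, T]] as [Phi], and [Phi_mean] applies. *)
generalize (RInt_scale Phi 2 0 T cPhi).
replace (2 * T) with (0 + INR 2 * T) by (simpl; ring). rewrite Rmult_0_r.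
rewrite RInt_periods by (apply cPhi || apply perPhi).
generalize Phi_mean. simpl. nra.
Qed.

End Slice.

(** * Reduction of the general case to even solutions *)

Lemma RInt_period_opp (f : R -> R) (T : R) :
  (forall x, continuous f x) -> (forall x, f (x + T) = f x) ->
  RInt (fun x => f (- x)) 0 T = RInt f 0 T.
Proof.
intros Hf HT.
assert (H := RInt_scale f (-1) 0 T Hf).
rewrite (RInt_ext _ (fun x => f (- x))) in H by (intros; f_equal; ring).
assert (H1 := RInt_chasles f (- T) 0 (- T) Hf).
assert (H2 := RInt_period f T (- T) Hf HT).
(* Of the form [I + I = I]: the integral over a degenerate interval is 0. *)
assert (H3 := RInt_chasles f (- T) (- T) (- T) Hf).
replace (- T + T) with 0 in H2 by ring.
replace (-1 * T) with (- T) in H by ring.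
rewrite Rmult_0_r in H. lra.
Qed.

Lemma continuous_affine (f : R -> R) (c k x : R) :
  (forall x, continuous f x) -> continuous (fun x => f (c + k * x)) x.
Proof.
intros Hf.
apply (continuous_comp (fun x => c + k * x) f); [|apply Hf].
apply (ex_derive_continuous (fun x => c + k * x)). auto_derive; auto.
Qed.

(** Passing to the even part in [t] keeps the values on t = 0 and, since reflection preserves
    integrals over a period, does not increase the double integral of the square. *)
Lemma slice_bound (T M : R) (E Es Ess Et Ett : R -> R -> R) :
  0 < T -> periodic_solution T M E Es Ess Et Ett ->
  T / 2 * RInt (fun s => E s 0 ^ 2) 0 T <=
  RInt (fun t => RInt (fun s => E s t ^ 2) 0 T) 0 T.
Proof.
intros HT HE.
pose (ev (f : R -> R -> R) s t := / 2 * (f s t + f s (-1 * t))).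
(* The [t]-derivative of the even part of [E] is the odd part of [Et]; a second derivative leads
   back to an even part. *)
pose (od (f : R -> R -> R) s t := / 2 * (f s t - f s (-1 * t))).
assert (H : periodic_solution T M (ev E) (ev Es) (ev Ess) (od Et) (ev Ett)).
{ destruct HE as [? ? ? ? ? ? ? ? ? eqE0 perS0 perT0]. unfold ev, od.
  constructor; try cont2_tac; intros s t.
  - apply (is_derive_scal (fun s => E s t + E s (-1 * t))).
    now apply (is_derive_plus (V := R_NormedModule)).
  - apply (is_derive_scal (fun s => Es s t + Es s (-1 * t))).
    now apply (is_derive_plus (V := R_NormedModule)).
  - apply (is_derive_scal (fun t => E s t + E s (-1 * t))).
    replace (Et s t - Et s (-1 * t)) with (Et s t + -1 * Et s (-1 * t)) by ring.
    apply (is_derive_plus (V := R_NormedModule)); auto.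
    apply is_derive_ext with (fun t => E s (0 + -1 * t)).
    { intros u; f_equal; ring. }
    apply is_derive_affine. now rewrite Rplus_0_l.
  - apply (is_derive_scal (fun t => Et s t - Et s (-1 * t))).
    replace (Ett s t + Ett s (-1 * t)) with (Ett s t - -1 * Ett s (-1 * t)) by ring.
    apply (is_derive_minus (V := R_NormedModule)); auto.
    apply is_derive_ext with (fun t => Et s (0 + -1 * t)).
    { intros u; f_equal; ring. }
    apply is_derive_affine. now rewrite Rplus_0_l.
  - generalize (eqE0 s t) (eqE0 s (-1 * t)). intros. lra.
  - now rewrite !perS0.
  - rewrite perT0. do 2 f_equal.
    rewrite <- (perT0 s (-1 * (t + T))). f_equal. ring. }
assert (Hev : forall s t, ev E s (- t) = ev E s t).
{ intros s t. unfold ev. rewrite Rplus_comm. do 2 f_equal; f_equal; ring. }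
assert (B := slice_bound_even T M _ _ _ _ _ HT H Hev).
assert (cE0 : cont2 E) by apply (cE _ _ _ _ _ _ _ HE).
pose (h t := RInt (fun s => E s t ^ 2) 0 T).
change (R -> R) in (type of h).
assert (ch : forall t, continuous h t).
{ intros t. apply (continuous_RInt_param (fun t s => E s t ^ 2)). cont2_tac. }
assert (ch' : forall t, continuous (fun t => h (- t)) t).
{ intros t. apply continuous_ext with (fun t => h (0 + -1 * t)).
  - intros; f_equal; ring.
  - now apply continuous_affine. }
rewrite (RInt_ext _ (fun s => E s 0 ^ 2)) in B.
2: { intros s _. eq_R. unfold ev. rewrite Rmult_0_r. field. }
apply (Rle_trans _ _ _ B).
apply Rle_trans with (RInt (fun t => / 2 * (h t + h (- t))) 0 T).
- apply RInt_le; [lra| | |].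
  + apply ex_RInt_cont. intros t.
    apply (continuous_RInt_param (fun t s => ev E s t ^ 2)).
    unfold ev. cont2_tac.
  + apply ex_RInt_cont. intros t.
    apply (continuous_scal_r (/ 2) (fun t => h t + h (- t))).
    now apply (continuous_plus h).
  + intros t _. unfold h.
    assert (cE1 : forall t s, continuous (fun s => E s t ^ 2) s).
    { intros u s. apply (cont2_l (fun s t => E s t ^ 2)). cont2_tac. }
    rewrite <- RInt_Rplus by auto.
    rewrite <- RInt_Rmult
      by (intros; now apply (continuous_plus (fun s => E s t ^ 2))).
    apply RInt_le; [lra| | |].
    -- apply ex_RInt_cont. intros s.
       apply (cont2_l (fun s t => ev E s t ^ 2)). unfold ev. cont2_tac.
    -- apply ex_RInt_cont. intros s.
       apply (cont2_l (fun s t => / 2 * (E s t ^ 2 + E s (- t) ^ 2))). cont2_tac.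
    (* The mean of the squares exceeds the square of the mean by a quarter of the squared
       difference. *)
    -- intros s _. unfold ev. replace (-1 * t) with (- t) by ring.
       generalize (pow2_ge_0 (E s t - E s (- t))). nra.
- rewrite (RInt_Rmult (fun t => h t + h (- t)))
    by (intros; now apply (continuous_plus h)).
  rewrite (RInt_Rplus h) by auto.
  rewrite (RInt_period_opp h); auto.
  + fold h. right. eq_R. field.
  + intros t. unfold h. apply RInt_ext. intros s _.
    now rewrite (perT _ _ _ _ _ _ _ HE).
Qed.

(** * The area integral over the finite covering of the torus *)

Lemma RInt_le_sub (f : R -> R) (a b c : R) :
  b <= c -> (forall x, continuous f x) -> (forall x, 0 <= f x) ->
  RInt f a b <= RInt f a c.
Proof.
intros Hbc Hf H0.
generalize (RInt_chasles f a b c Hf) (RInt_ge0 f b c Hbc Hf H0). lra.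
Qed.

(* The inner integral of [f] along (q, p) is constant on the lines of that
   direction, hence a function [h] of the ordinate where the line meets the
   vertical axis; the outer integral only meets finitely many periods of [h]. *)
Lemma area_bound (f : R -> R -> R) (T x0 y0 : R) (p : Z) (q : nat) :
  0 < T -> (0 < q)%nat -> cont2 f -> (forall x y, 0 <= f x y) ->
  (forall (m n : Z) x y, f (x + T * IZR m) (y + T * IZR n) = f x y) ->
  RInt (fun t => RInt (fun s =>
     f (x0 + INR q * s - IZR p * t) (y0 + IZR p * s + INR q * t)) 0 T) 0 T
  <= INR q * RInt (fun x => RInt (fun y => f x y) 0 T) 0 T.
Proof.
intros HT Hq cf f0 perf.
assert (Hq1 : 1 <= INR q) by now apply (le_INR 1).
set (g x y := RInt (fun s => f (x + INR q * s) (y + IZR p * s)) 0 T).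
change (R -> R -> R) in (type of g).
set (h z := g 0 z).
assert (ch : forall z, continuous h z).
{ intros z. apply (continuous_RInt_param (fun z s => f (0 + INR q * s) (z + IZR p * s))).
  cont2_tac. }
assert (h0 : forall z, 0 <= h z).
{ intros z. apply RInt_ge0; [lra| |auto]. intros s.
  apply (cont2_r (fun z s => f (0 + INR q * s) (z + IZR p * s))). cont2_tac. }
assert (hper : forall z, h (z + T) = h z).
{ intros z. apply RInt_ext. intros s _. eq_R.
  rewrite <- (perf 0%Z 1%Z _ (z + _)). f_equal; simpl; ring. }
(* Shifting the parameter by [x / q] moves the base point along (q, p) to the vertical axis; the
   integrand has period [T] in [s], so the integral is unchanged. *)
assert (gh : forall x y, g x y = h (y - x * IZR p / INR q)).
{ intros x y. unfold h, g.
  set (k s := f (0 + INR q * s) (y - x * IZR p / INR q + IZR p * s)).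
  assert (ck : forall s, continuous k s).
  { intros s. apply (cont2_r (fun z s => f (0 + INR q * s) (z + IZR p * s))).
    cont2_tac. }
  rewrite <- (RInt_period k T (x / INR q)); auto.
  - replace (x / INR q + T) with (T + x / INR q) by ring.
    rewrite <- (Rplus_0_l (x / INR q)) at 1.
    rewrite <- RInt_shift by auto.
    apply RInt_ext. intros s _. unfold k. f_equal; field; lra.
  - intros s. unfold k.
    rewrite <- (perf (Z.of_nat q) p (0 + INR q * s)), <- INR_IZR_INZ.
    f_equal; ring. }
set (N := Z.to_nat (p * p + Z.of_nat q * Z.of_nat q)).
assert (HN : INR N = IZR p * IZR p + INR q * INR q).
{ unfold N. rewrite INR_IZR_INZ, Z2Nat.id by nia.
  rewrite plus_IZR, !mult_IZR, <- INR_IZR_INZ. reflexivity. }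
(* Moving by [t] along (-p, q) raises the ordinate on the vertical axis by t (q + p^2 / q), which is
   [k * t]. *)
set (k := INR N / INR q).
assert (Hk : k * INR q = INR N) by (unfold k; field; lra).
assert (N0 : 0 < INR N) by (rewrite HN; nra).
assert (k0 : 0 < k) by (apply Rdiv_lt_0_compat; lra).
set (c := y0 - x0 * IZR p / INR q).
rewrite (RInt_ext _ (fun t => h (c + k * t))).
2: { intros t _. transitivity (g (x0 - IZR p * t) (y0 + INR q * t)).
     - apply RInt_ext. intros s _. f_equal; ring.
     - rewrite gh. f_equal. unfold c, k. rewrite HN. field. lra. }
(* After the integrals are exchanged, the shift by [IZR p * s] disappears by periodicity in [y] and
   the factor [INR q] by periodicity in [x]. *)
assert (Hh : RInt h 0 T = RInt (fun x => RInt (fun y => f x y) 0 T) 0 T).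
{ set (H x := RInt (fun y => f x y) 0 T).
  change (R -> R) in (type of H).
  assert (cH : forall x, continuous H x)
    by (intros; now apply continuous_RInt_param).
  assert (HH : RInt (fun s => H (INR q * s)) 0 T = RInt H 0 T).
  { apply Rmult_eq_reg_l with (INR q); [|lra].
    rewrite RInt_scale by auto. rewrite Rmult_0_r.
    rewrite <- (RInt_periods H T 0); auto.
    - f_equal. ring.
    - intros x. apply RInt_ext. intros y _. eq_R.
      rewrite <- (perf 1%Z 0%Z x). f_equal; simpl; ring. }
  rewrite <- HH. unfold h, g.
  rewrite (RInt_fubini (fun z s => f (0 + INR q * s) (z + IZR p * s)))
    by cont2_tac.
  apply RInt_ext. intros s _. unfold H. rewrite Rplus_0_l.
  rewrite (RInt_shift (fun z => f (INR q * s) z)) by (intros; now apply cont2_r).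
  rewrite Rplus_0_l, (Rplus_comm T). apply RInt_period.
  - intros; now apply cont2_r.
  - intros y. rewrite <- (perf 0%Z 1%Z _ y). f_equal; simpl; ring. }
rewrite <- Hh.
apply Rmult_le_reg_l with k; auto.
replace (k * (INR q * RInt h 0 T)) with (INR N * RInt h 0 T)
  by (rewrite <- Hk; eq_R; ring).
rewrite <- (RInt_periods h T 0 N) by auto.
assert (S : k * RInt (fun t => h (c + k * t)) 0 T = RInt h c (c + k * T)).
{ assert (S := RInt_scale (fun z => h (z + c)) k 0 T).
  rewrite RInt_shift in S by auto.
  rewrite Rmult_0_r, Rplus_0_l, (Rplus_comm (k * T)) in S.
  rewrite <- S.
  - f_equal. apply RInt_ext. intros; f_equal; ring.
  - intros x. apply continuous_ext with (fun z => h (c + 1 * z)).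
    + intros; f_equal; ring.
    + now apply continuous_affine. }
rewrite S.
rewrite (RInt_periods h T 0 N), <- (RInt_periods h T c N) by auto.
(* Since [q] is at least 1, an interval of length [k * T] fits into [N] periods of the nonnegative
   [h]. *)
apply RInt_le_sub; auto.
apply Rplus_le_compat_l, Rmult_le_compat_r; [lra|]. nra.
Qed.

(** * Rotated and dilated coordinates *)

Lemma is_derive_line (f fx fy : R -> R -> R) (a b k l t : R) :
  (forall x y, is_derive (fun x => f x y) x (fx x y)) ->
  (forall x y, is_derive (fun y => f x y) y (fy x y)) ->
  cont2 fx ->
  is_derive (fun t => f (a + k * t) (b + l * t)) t
    (k * fx (a + k * t) (b + l * t) + l * fy (a + k * t) (b + l * t)).
Proof.
intros Hx Hy cx.
assert (aff : forall a k, derivable_pt_lim (fun t => a + k * t) t k).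
{ intros a' k'. apply is_derive_Reals. auto_derive; auto; ring. }
apply is_derive_Reals.
rewrite (Rmult_comm k (fx _ _)), (Rmult_comm l (fy _ _)).
apply (derivable_pt_lim_comp_2d f (fun t => a + k * t) (fun t => b + l * t)); auto.
(* A continuous partial derivative in [x] and a partial derivative in [y] give joint
   differentiability, hence the chain rule. *)
apply filterdiff_differentiable_pt_lim.
apply (is_derive_filterdiff f (a + k * t) (b + l * t) fx (fy (a + k * t) (b + l * t))).
- apply filter_forall. intros u. apply Hx.
- apply Hy.
- apply (proj1 (continuity_2d_pt_filterlim fx _ _)), cx.
Qed.

(** The vectors (q, p) and (-p, q) are orthogonal of equal length, so the Laplacian is multiplied by
    p^2 + q^2; their entries are integers, so [T] remains a period in both variables. *)
Lemma rotated_solution (u : R -> R -> R) (T L x0 y0 : R) (p q : Z) :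
  (forall (m n : Z) x y, u (x + T * IZR m) (y + T * IZR n) = u x y) ->
  (forall x y, ex_diff_n u 2 x y) ->
  (forall x y, - real_laplacian u x y = L * u x y) ->
  exists Es Ess Et Ett,
    periodic_solution T (L * (IZR p ^ 2 + IZR q ^ 2))
      (fun s t => u (x0 + IZR q * s - IZR p * t) (y0 + IZR p * s + IZR q * t))
      Es Ess Et Ett.
Proof.
intros per C2 lap.
set (P := IZR p). set (Q := IZR q).
set (ux x y := Derive (fun z => u z y) x).
set (uy x y := Derive (fun z => u x z) y).
set (uxx x y := Derive (fun z => ux z y) x).
set (uxy x y := Derive (fun z => ux x z) y).
set (uyx x y := Derive (fun z => uy z y) x).
set (uyy x y := Derive (fun z => uy x z) y).
assert (cu : cont2 u) by (intros x y; apply (C2 x y)).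
assert (cux : cont2 ux) by (intros x y; apply (C2 x y)).
assert (cuy : cont2 uy) by (intros x y; apply (C2 x y)).
assert (cuxx : cont2 uxx) by (intros x y; apply (C2 x y)).
assert (cuxy : cont2 uxy) by (intros x y; apply (C2 x y)).
assert (cuyx : cont2 uyx) by (intros x y; apply (C2 x y)).
assert (cuyy : cont2 uyy) by (intros x y; apply (C2 x y)).
assert (dux : forall x y, is_derive (fun x => u x y) x (ux x y))
  by (intros x y; apply Derive_correct, (C2 x y)).
assert (duy : forall x y, is_derive (fun y => u x y) y (uy x y))
  by (intros x y; apply Derive_correct, (C2 x y)).
assert (duxx : forall x y, is_derive (fun x => ux x y) x (uxx x y))
  by (intros x y; apply Derive_correct, (C2 x y)).
assert (duxy : forall x y, is_derive (fun y => ux x y) y (uxy x y))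
  by (intros x y; apply Derive_correct, (C2 x y)).
assert (duyx : forall x y, is_derive (fun x => uy x y) x (uyx x y))
  by (intros x y; apply Derive_correct, (C2 x y)).
assert (duyy : forall x y, is_derive (fun y => uy x y) y (uyy x y))
  by (intros x y; apply Derive_correct, (C2 x y)).
set (X s t := x0 + Q * s - P * t). set (Y s t := y0 + P * s + Q * t).
assert (line_s : forall f fx fy s t,
  (forall x y, is_derive (fun x => f x y) x (fx x y)) ->
  (forall x y, is_derive (fun y => f x y) y (fy x y)) -> cont2 fx ->
  is_derive (fun s => f (X s t) (Y s t)) s
    (Q * fx (X s t) (Y s t) + P * fy (X s t) (Y s t))).
{ intros f fx fy s t Hx Hy cx.
  assert (D := is_derive_line f fx fy (x0 - P * t) (y0 + Q * t) Q P s Hx Hy cx).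
  replace (X s t) with (x0 - P * t + Q * s) by (unfold X; ring).
  replace (Y s t) with (y0 + Q * t + P * s) by (unfold Y; ring).
  revert D. apply is_derive_ext. intros z. unfold X, Y. f_equal; ring. }
assert (line_t : forall f fx fy s t,
  (forall x y, is_derive (fun x => f x y) x (fx x y)) ->
  (forall x y, is_derive (fun y => f x y) y (fy x y)) -> cont2 fx ->
  is_derive (fun t => f (X s t) (Y s t)) t
    (- P * fx (X s t) (Y s t) + Q * fy (X s t) (Y s t))).
{ intros f fx fy s t Hx Hy cx.
  assert (D := is_derive_line f fx fy (x0 + Q * s) (y0 + P * s) (- P) Q t Hx Hy cx).
  replace (X s t) with (x0 + Q * s + - P * t) by (unfold X; ring).
  replace (Y s t) with (y0 + P * s + Q * t) by (unfold Y; ring).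
  revert D. apply is_derive_ext. intros z. unfold X, Y. f_equal; ring. }
assert (cX : cont2 X) by (unfold X; cont2_tac).
assert (cY : cont2 Y) by (unfold Y; cont2_tac).
exists (fun s t => Q * ux (X s t) (Y s t) + P * uy (X s t) (Y s t)),
  (fun s t => Q * (Q * uxx (X s t) (Y s t) + P * uxy (X s t) (Y s t))
            + P * (Q * uyx (X s t) (Y s t) + P * uyy (X s t) (Y s t))),
  (fun s t => - P * ux (X s t) (Y s t) + Q * uy (X s t) (Y s t)),
  (fun s t => - P * (- P * uxx (X s t) (Y s t) + Q * uxy (X s t) (Y s t))
            + Q * (- P * uyx (X s t) (Y s t) + Q * uyy (X s t) (Y s t))).
constructor.
- intros s t. now apply line_s.
- intros s t. apply (is_derive_plus (V := R_NormedModule)).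
  + apply (is_derive_scal (fun s => ux (X s t) (Y s t))). now apply line_s.
  + apply (is_derive_scal (fun s => uy (X s t) (Y s t))). now apply line_s.
- intros s t. now apply line_t.
- intros s t. apply (is_derive_plus (V := R_NormedModule)).
  + apply (is_derive_scal (fun t => ux (X s t) (Y s t))). now apply line_t.
  + apply (is_derive_scal (fun t => uy (X s t) (Y s t))). now apply line_t.
- apply (cont2_comp u); auto.
- cont2_tac.
- cont2_tac.
- cont2_tac.
- cont2_tac.
- intros s t. fold (X s t) (Y s t).
  assert (H : - (uxx (X s t) (Y s t) + uyy (X s t) (Y s t)) = L * u (X s t) (Y s t))
    by apply lap.
  (* The mixed terms cancel, [uxy] against [uxy] and [uyx] against [uyx]. *)
  transitivity ((P ^ 2 + Q ^ 2) * (uxx (X s t) (Y s t) + uyy (X s t) (Y s t))).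
  + ring.
  + replace (uxx (X s t) (Y s t) + uyy (X s t) (Y s t))
      with (- (L * u (X s t) (Y s t))) by lra. ring.
- intros s t. rewrite <- (per q p (x0 + Q * s - P * t)). f_equal; unfold P, Q; ring.
- intros s t. rewrite <- (per (- p)%Z q (x0 + Q * s - P * t)), opp_IZR. f_equal; unfold P, Q; ring.
Qed.

(** * From the closed line to the unit segment *)

Lemma RInt_scaled_le_period (f : R -> R) (T k : R) :
  0 < T -> k <> 0 -> Rabs k <= T ->
  (forall x, continuous f x) -> (forall x, 0 <= f x) ->
  (forall x, f (x + T) = f x) ->
  RInt (fun t => f (k * t)) 0 1 <= RInt f 0 T / Rabs k.
Proof.
intros HT Hk0 HkT Hf f0 Hper.
assert (S := RInt_scale f k 0 1 Hf).
rewrite Rmult_0_r, Rmult_1_r in S.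
assert (Hk : 0 < Rabs k) by now apply Rabs_pos_lt.
apply Rmult_le_reg_l with (Rabs k); auto.
replace (Rabs k * (RInt f 0 T / Rabs k)) with (RInt f 0 T)
  by (symmetry; eq_R; field; lra).
revert HkT Hk. unfold Rabs. destruct (Rcase_abs k) as [h|h]; intros HkT Hk.
(* For [k < 0] the substitution leads to the interval from [k] to 0, contained in the period from
   [- T] to 0. *)
- assert (C1 := RInt_chasles f (- T) k 0 Hf).
  assert (C2 := RInt_chasles f k 0 k Hf).
  assert (C3 := RInt_chasles f k k k Hf).
  assert (P1 := RInt_period f T (- T) Hf Hper).
  replace (- T + T) with 0 in P1 by ring.
  assert (G := RInt_ge0 f (- T) k ltac:(lra) Hf f0).
  lra.
- rewrite S. apply RInt_le_sub; auto.
Qed.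

(** The hypothesis on [k] says that [k] times (q, p) is a unit vector. The covering contributes the
    factor [INR q], the change of parameter the factor p^2 + q^2. *)
Lemma real_restriction_bound (u : R -> R -> R) (L x0 y0 k : R) (p : Z) (q : nat) :
  (0 < q)%nat ->
  (forall (m n : Z) x y, u (x + 2 * PI * IZR m) (y + 2 * PI * IZR n) = u x y) ->
  (forall x y, ex_diff_n u 2 x y) ->
  (forall x y, - real_laplacian u x y = L * u x y) ->
  k ^ 2 * (IZR p ^ 2 + INR q ^ 2) = 1 ->
  RInt (fun t => u (x0 + t * (INR q * k)) (y0 + t * (IZR p * k)) ^ 2) 0 1 <=
  (IZR p ^ 2 + INR q ^ 2) * INR q *
    RInt (fun x => RInt (fun y => u x y ^ 2) 0 (2 * PI)) 0 (2 * PI).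
Proof.
intros Hq per C2 lap Hk.
assert (Hq1 : 1 <= INR q) by now apply (le_INR 1).
assert (Hpi : 1 < PI) by (generalize PI2_1; lra).
set (T := 2 * PI) in *.
assert (HT : 2 < T) by (unfold T; lra).
destruct (rotated_solution u T L x0 y0 p (Z.of_nat q) per C2 lap)
  as (Es & Ess & Et & Ett & HE).
rewrite <- INR_IZR_INZ in HE.
assert (B := slice_bound T _ _ _ _ _ _ ltac:(lra) HE). cbv beta in B.
assert (cu : cont2 u) by (intros x y; apply (C2 x y)).
assert (A := area_bound (fun x y => u x y ^ 2) T x0 y0 p q ltac:(lra) Hq
  ltac:(cont2_tac) (fun x y => pow2_ge_0 _)
  ltac:(intros; simpl; now rewrite per)).
set (F s := u (x0 + INR q * s) (y0 + IZR p * s) ^ 2).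
assert (cF : forall s, continuous F s).
{ intros s. apply (cont2_r (fun _ s => u (x0 + INR q * s) (y0 + IZR p * s) ^ 2) 0).
  cont2_tac. }
assert (Fper : forall s, F (s + T) = F s).
{ intros s. unfold F. f_equal.
  rewrite <- (per (Z.of_nat q) p (x0 + INR q * s)), <- INR_IZR_INZ.
  f_equal; ring. }
set (N := IZR p ^ 2 + INR q ^ 2) in *.
assert (HN : 1 <= N) by (unfold N; nra).
assert (k0 : k <> 0) by (intros h; rewrite h in Hk; lra).
assert (ak : Rabs k ^ 2 = k ^ 2) by apply pow2_abs.
assert (ak0 : 0 < Rabs k) by now apply Rabs_pos_lt.
assert (ak1 : Rabs k <= 1) by nra.
assert (R1 := RInt_scaled_le_period F T k ltac:(lra) k0 ltac:(lra) cF
  (fun s => pow2_ge_0 _) Fper).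
rewrite (RInt_ext _ (fun t => F (k * t)))
  by (intros; unfold F; do 2 f_equal; ring).
apply (Rle_trans _ _ _ R1).
unfold Rdiv.
(* [N * Rabs k] is the inverse of [Rabs k] because [k ^ 2 * N = 1]. *)
replace (RInt F 0 T * / Rabs k) with (N * Rabs k * RInt F 0 T)
  by (replace (/ Rabs k) with (N * Rabs k);
      [eq_R; ring | apply Rmult_eq_reg_l with (Rabs k); [rewrite Rinv_r|]; nra]).
assert (F0 : 0 <= RInt F 0 T)
  by (apply RInt_ge0; auto; [lra | intros; apply pow2_ge_0]).
assert (FA : RInt F 0 T <= INR q * RInt (fun x => RInt (fun y => u x y ^ 2) 0 T) 0 T).
{ apply Rle_trans with (T / 2 * RInt F 0 T); [nra|].
  refine (Rle_trans _ _ _ _ A). refine (Rle_trans _ _ _ _ B).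
  right. f_equal. apply RInt_ext. intros s _. unfold F.
  eq_R. do 2 f_equal; ring. }
rewrite (Rmult_assoc N (INR q)), (Rmult_assoc N (Rabs k)).
apply Rmult_le_compat_l; [lra|]. refine (Rle_trans _ _ _ _ FA). nra.
Qed.

Theorem theorem2 :
  forall a : Q,
  exists Ca : R, 0 < Ca /\
    forall P Q : R * R,
      has_slope (Q2R a) P Q -> segment_length P Q = 1 ->
    forall lambda : R, 1 < lambda ->
    forall e : R -> R -> C, eigenfunction lambda e ->
      L2norm_segment e P Q <= Ca * L2norm_torus e.
Proof.
intros a.
set (p := Qnum a). set (q := Pos.to_nat (Qden a)).
assert (Hq : (0 < q)%nat) by apply Pos2Nat.is_pos.
assert (Hq1 : 1 <= INR q) by now apply (le_INR 1).
(* [C0] bounds the ratio of the squared norms, hence the square root in the witness. *)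
set (C0 := (IZR p ^ 2 + INR q ^ 2) * INR q).
assert (HC : 0 < C0) by (unfold C0; nra).
exists (sqrt C0). split; [now apply sqrt_lt_R0|].
intros P Q Hs Hl lambda _ e [per [C2 lap]].
unfold L2norm_segment, L2norm_torus.
rewrite <- sqrt_mult_alt by lra.
apply sqrt_le_1_alt.
assert (Ha : Q2R a = IZR p / INR q).
{ unfold Q2R, p, q. rewrite INR_IZR_INZ, positive_nat_Z. reflexivity. }
unfold has_slope in Hs. rewrite Ha in Hs.
(* With this [k] the segment has direction vector [k] times (q, p). *)
set (k := (fst Q - fst P) / INR q).
assert (HX : fst Q - fst P = INR q * k) by (unfold k; field; lra).
assert (HY : snd Q - snd P = IZR p * k) by (rewrite Hs; unfold k; field; lra).
assert (Hk : k ^ 2 * (IZR p ^ 2 + INR q ^ 2) = 1).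
{ unfold segment_length in Hl. rewrite HX, HY in Hl.
  replace (k ^ 2 * (IZR p ^ 2 + INR q ^ 2))
    with ((INR q * k) ^ 2 + (IZR p * k) ^ 2) by ring.
  rewrite <- (sqrt_sqrt ((INR q * k) ^ 2 + (IZR p * k) ^ 2)) by nra.
  rewrite Hl. ring. }
rewrite Hl, HX, HY.
(* As [lambda ^ 2] is real, real and imaginary parts solve the same equation; each satisfies the
   bound with the constant [C0], and the squares add up. *)
set (u x y := Re (e x y)). set (v x y := Im (e x y)).
assert (lapu : forall x y, - real_laplacian u x y = lambda ^ 2 * u x y).
{ intros x y. assert (H := f_equal Re (lap x y)).
  change (- real_laplacian u x y = lambda ^ 2 * u x y - 0 * v x y) in H. lra. }
assert (lapv : forall x y, - real_laplacian v x y = lambda ^ 2 * v x y).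
{ intros x y. assert (H := f_equal Im (lap x y)).
  change (- real_laplacian v x y = lambda ^ 2 * v x y + 0 * u x y) in H. lra. }
assert (Hu := real_restriction_bound u (lambda ^ 2) (fst P) (snd P) k p q Hq
  ltac:(intros; unfold u; now rewrite per) (fun x y => proj1 (C2 x y))
  lapu Hk).
assert (Hv := real_restriction_bound v (lambda ^ 2) (fst P) (snd P) k p q Hq
  ltac:(intros; unfold v; now rewrite per) (fun x y => proj2 (C2 x y))
  lapv Hk).
fold C0 in Hu, Hv.
assert (cu : cont2 u) by (intros x y; apply (C2 x y)).
assert (cv : cont2 v) by (intros x y; apply (C2 x y)).
assert (Hmod : forall x y, Cmod (e x y) ^ 2 = u x y ^ 2 + v x y ^ 2).
{ intros x y. unfold Cmod. rewrite pow2_sqrt; [reflexivity|].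
  generalize (pow2_ge_0 (fst (e x y))) (pow2_ge_0 (snd (e x y))). lra. }
assert (seg : forall w, cont2 w -> forall t,
  continuous (fun t => w (fst P + t * (INR q * k)) (snd P + t * (IZR p * k)) ^ 2) t).
{ intros w cw t.
  apply (cont2_r (fun _ t => w (fst P + t * (INR q * k)) (snd P + t * (IZR p * k)) ^ 2) 0).
  cont2_tac. }
rewrite (RInt_ext _ (fun t =>
    u (fst P + t * (INR q * k)) (snd P + t * (IZR p * k)) ^ 2
  + v (fst P + t * (INR q * k)) (snd P + t * (IZR p * k)) ^ 2))
  by (intros; now rewrite Hmod, Rmult_1_r).
rewrite RInt_Rplus by now apply seg.
rewrite (RInt_ext (fun x => RInt (fun y => Cmod (e x y) ^ 2) 0 (2 * PI))
  (fun x => RInt (fun y => u x y ^ 2) 0 (2 * PI)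
          + RInt (fun y => v x y ^ 2) 0 (2 * PI))).
2: { intros x _. rewrite <- RInt_Rplus.
     - apply RInt_ext. intros; apply Hmod.
     - intros; apply (cont2_r (fun x y => u x y ^ 2)). cont2_tac.
     - intros; apply (cont2_r (fun x y => v x y ^ 2)). cont2_tac. }
rewrite RInt_Rplus.
- rewrite Rmult_plus_distr_l. now apply Rplus_le_compat.
- intros; apply (continuous_RInt_param (fun x y => u x y ^ 2)). cont2_tac.
- intros; apply (continuous_RInt_param (fun x y => v x y ^ 2)). cont2_tac.
Qed.
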